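(* Let $R$ be a finite Frobenius ring (not necessarily commutative) and let $w:R\to\mathbb{Q}$ be a bi-invariant weight on $R$. Then $w$ satisfies the Extension Property if and only if its orthogonality matrix $$W_0=\big(w(rs)\big)_{Rr\ne 0,\; sR\ne 0}$$ (rows indexed by the nonzero principal left ideals $Rr$ of $R$, columns by the nonzero principal right ideals $sR$ of $R$) is invertible.
   Context: All rings are finite, associative, with identity $1$, not necessarily commutative; modules are unital. $R^\times$ is the group of units of $R$. A finite ring $R$ is Frobenius if ${}_RR\cong {}_R\widehat{R}$ as left $R$-modules, where $\widehat{R}=\mathrm{Hom}_{\mathbb{Z}}(R,\mathbb{C}^\times)$ is the character group of $(R,+)$ with left action $({}^r\chi)(x)=\chi(xr)$; equivalently, the left socle (sum of all minimal left ideals) is a principal left ideal. A weight on $R$ is any function $w: R \to \mathbb{Q}$, without any further properties presumed; it is extended to $R^n$ by $w(x)=\sum_{i=1}^n w(x_i)$. It is bi-invariant if $w(ux)=w(x)=w(xu)$ for all $x\in R$, $u\in R^\times$. In a finite Frobenius ring two elements generate the same left (right) ideal iff they differ by left (right) multiplication by a unit, so for bi-invariant $w$ the value $w(rs)$ depends only on $Rr$ and $sR$. The matrix $W_0$ has rational entries and is square, since a finite Frobenius ring has equally many principal left and principal right ideals (a known fact). The right symmetry group of $w$ is $G_{\mathrm{rt}}(w)=\{v\in R^\times : w(xv)=w(x) \text{ for all } x\in R\}$ (which equals $R^\times$ for bi-invariant $w$). A linear code of length $n$ is a left submodule $C\le {}_RR^n$. A $w$-isometry is a left $R$-linear map $\varphi: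 C\to {}_RR^n$ with $w(\varphi(x))=w(x)$ for all $x\in C$. A $G_{\mathrm{rt}}(w)$-monomial transformation of $R^n$ is a map $\Phi(x_1,\dots,x_n)=(x_{\pi(1)}u_1,\dots,x_{\pi(n)}u_n)$ with $\pi\in S_n$ and $u_1,\dots,u_n\in G_{\mathrm{rt}}(w)$. $R$ and $w$ satisfy the Extension Property if for every $n\ge 1$ and every linear code $C\le {}_RR^n$, every injective $w$-isometry $\varphi: C\to {}_RR^n$ is the restriction to $C$ of a $G_{\mathrm{rt}}(w)$-monomial transformation of $R^n$.
   Formalization: The weight is additionally assumed to satisfy w(0)=0; without this the claim is false (R=F_2, w constantly 1: W_0=(1) is invertible, but the isometry (a,0)->(a,a) is not monomial). *)

(* Defs.v *)
From HB Require Import structures.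
From mathcomp Require Import all_boot all_order all_fingroup all_algebra all_field.

Set Implicit Arguments.
Unset Strict Implicit.
Unset Printing Implicit Defensive.

Import GRing.Theory.

Local Open Scope ring_scope.

(* The module Hom_Z(R, algC^x).  The characters of a finite group take values in roots of
   unity, so algC stands for the complex numbers, as in the character library. *)
Definition is_addchar (R : finUnitRingType) (chi : {ffun R -> algC}) : bool :=
  [forall x, chi x != 0] && [forall x, forall y, chi (x + y) == chi x * chi y].

Record addchar (R : finUnitRingType) := AddChar {
  addchar_val :> {ffun R -> algC};
  _ : is_addchar addchar_val }.

HB.instance Definition _ (R : finUnitRingType) :=
  [isSub for @addchar_val R].
HB.instance Definition _ (R : finUnitRingType) :=
  [Choice of addchar R by <:].

Section CharacterModule.
Variable R : finUnitRingType.
Implicit Types (chi psi : addchar R) (r x y : R).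

Lemma addchar_neq0 chi x : chi x != 0.
Proof. by case: chi => f /= /andP[/forallP]. Qed.

Lemma addcharD chi x y : chi (x + y) = chi x * chi y.
Proof. by case: chi => f /= /andP[_ /forallP/(_ x)/forallP/(_ y)/eqP]. Qed.

Lemma addcharP chi psi : (forall x, chi x = psi x) -> chi = psi.
Proof. by move=> eq_f; apply/val_inj/ffunP. Qed.

Lemma addchar_zero_subproof : is_addchar ([ffun=> 1] : {ffun R -> algC}).
Proof.
apply/andP; split; apply/forallP=> x; first by rewrite ffunE oner_eq0.
by apply/forallP=> y; rewrite !ffunE mulr1.
Qed.

Lemma addchar_add_subproof chi psi :
  is_addchar [ffun x => chi x * psi x].
Proof.
apply/andP; split; apply/forallP=> x.
  by rewrite ffunE mulf_neq0 ?addchar_neq0.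
by apply/forallP=> y; rewrite !ffunE !addcharD mulrACA.
Qed.

Lemma addchar_opp_subproof chi : is_addchar [ffun x => (chi x)^-1].
Proof.
apply/andP; split; apply/forallP=> x.
  by rewrite ffunE invr_neq0 ?addchar_neq0.
by apply/forallP=> y; rewrite !ffunE !addcharD invfM.
Qed.

Lemma addchar_scale_subproof r chi : is_addchar [ffun x => chi (x * r)].
Proof.
apply/andP; split; apply/forallP=> x; first by rewrite ffunE addchar_neq0.
by apply/forallP=> y; rewrite !ffunE mulrDl addcharD.
Qed.

Definition addchar_zero := AddChar addchar_zero_subproof.
Definition addchar_add chi psi := AddChar (addchar_add_subproof chi psi).
Definition addchar_opp chi := AddChar (addchar_opp_subproof chi).
Definition addchar_scale r chi := AddChar (addchar_scale_subproof r chi).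

Lemma addchar_addA : associative addchar_add.
Proof. by move=> a b c; apply: addcharP => x; rewrite !ffunE mulrA. Qed.

Lemma addchar_addC : commutative addchar_add.
Proof. by move=> a b; apply: addcharP => x; rewrite !ffunE mulrC. Qed.

Lemma addchar_add0 : left_id addchar_zero addchar_add.
Proof. by move=> a; apply: addcharP => x; rewrite !ffunE mul1r. Qed.

Lemma addchar_addN : left_inverse addchar_zero addchar_opp addchar_add.
Proof.
by move=> a; apply: addcharP => x; rewrite !ffunE mulVf ?addchar_neq0.
Qed.

HB.instance Definition _ := GRing.isZmodule.Build (addchar R)
  addchar_addA addchar_addC addchar_add0 addchar_addN.

Lemma addchar_scaleA r s chi :
  addchar_scale r (addchar_scale s chi) = addchar_scale (r * s) chi.
Proof. by apply: addcharP => x; rewrite !ffunE mulrA. Qed.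

Lemma addchar_scale1 : left_id 1 addchar_scale.
Proof. by move=> a; apply: addcharP => x; rewrite !ffunE mulr1. Qed.

Lemma addchar_scaleDr : right_distributive addchar_scale +%R.
Proof. by move=> r a b; apply: addcharP => x; rewrite !ffunE. Qed.

Lemma addchar_scaleDl chi : {morph addchar_scale^~ chi : r s / r + s}.
Proof. by move=> r s; apply: addcharP => x; rewrite !ffunE mulrDr addcharD. Qed.

HB.instance Definition _ := GRing.Zmodule_isLmodule.Build R (addchar R)
  addchar_scaleA addchar_scale1 addchar_scaleDr addchar_scaleDl.

End CharacterModule.

Definition frobenius_ring (R : finUnitRingType) : Prop :=
  exists f : {linear R^o -> addchar R}, bijective f.

Section Weights.
Variables (R : finUnitRingType) (w : R -> rat).

Definition bi_invariant : Prop :=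
  forall x u : R, u \is a GRing.unit -> w (u * x) = w x /\ w (x * u) = w x.

Definition code_weight (n : nat) (x : 'rV[R]_n) : rat := \sum_(i < n) w (x 0 i).

Definition right_symmetry (v : R) : Prop :=
  v \is a GRing.unit /\ forall x : R, w (x * v) = w x.

Definition monomial_map (n : nat) (s : 'S_n) (u : 'I_n -> R) (x : 'rV[R]_n) :
  'rV[R]_n := \row_i (x 0 (s i) * u i).

(* A map C -> R^n is given by a total function on R^n of which only the
   restriction to C is used. *)
Definition isometry_on (n : nat) (C : {set 'rV[R]_n})
    (f : 'rV[R]_n -> 'rV[R]_n) : Prop :=
  {in C &, forall x y, forall a : R, f (a *: x + y) = a *: f x + f y} /\
  {in C, forall x, code_weight (f x) = code_weight x}.

Definition extension_property : Prop :=
  forall n : nat, (0 < n)%N ->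
  forall C : {set 'rV[R]_n}, submod_closed C ->
  forall f : 'rV[R]_n -> 'rV[R]_n, isometry_on C f -> {in C &, injective f} ->
  exists (s : 'S_n) (u : 'I_n -> R),
    (forall i, right_symmetry (u i)) /\ {in C, f =1 monomial_map s u}.

End Weights.

Section OrthogonalityMatrix.
Variable R : finUnitRingType.

Definition lideal (r : R) : {set R} := [set x * r | x : R].
Definition rideal (s : R) : {set R} := [set s * x | x : R].

Definition nz_lideals : {set {set R}} :=
  [set lideal r | r : R & lideal r != [set 0]].
Definition nz_rideals : {set {set R}} :=
  [set rideal s | s : R & rideal s != [set 0]].

(* Some generator of a principal ideal; the default 0 is never used on
   nz_lideals and nz_rideals. *)
Definition lgen (I : {set R}) : R := odflt 0 [pick r | lideal r == I].
Definition rgen (J : {set R}) : R := odflt 0 [pick s | rideal s == J].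

(* Over a Frobenius ring and for a bi-invariant w, the entries do not depend
   on the chosen generators.  Adding a constant to w keeps the isometries but
   changes this matrix, so it characterises the extension property only for
   w normalised by w 0 = 0 (w = 1 on F_2 is a counterexample otherwise). *)
Definition orthogonality_mx (w : R -> rat) :
    'M[rat]_(#|nz_lideals|, #|nz_rideals|) :=
  \matrix_(i, j) w (lgen (enum_val i) * rgen (enum_val j)).

End OrthogonalityMatrix.

(* The numbers of rows and columns of orthogonality_mx are equal over a
   Frobenius ring, but not by conversion, so unitmx does not apply. *)
Definition mx_invertible (m n : nat) (A : 'M[rat]_(m, n)) : Prop :=
  exists B : 'M[rat]_(n, m), A *m B = 1%:M /\ B *m A = 1%:M.

(* Main.v *)
Require Import Defs.
From HB Require Import structures.
From mathcomp Require Import all_boot all_order all_fingroup all_algebra all_field.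

(* Write c_J(x) for the number of entries of a word x generating the right ideal J.
   If W_0 has a left inverse, the values w(r x), r in R, determine c_J(x) for every
   J <> 0, so a w-isometry preserves the number of zero entries; the theorem then
   reduces to the MacWilliams extension theorem for the Hamming weight, proved by Wood's
   method: with a generating character rho, the zeros of x are counted by the sums of
   rho(x_i r) over r, linear independence of characters on the code turns this into an
   equality of multisets of functionals, and functionals generating the same cyclic right
   module differ by a unit.
   Conversely, an integral kernel vector of W_0, split into positive and negative parts,
   yields two words x, y with w(r x) = w(r y) for all r; prepending 1 to both makes
   r x |-> r y an injective isometry, and its monomial extension forces c_J(x) = c_J(y).
   So W_0 has independent columns, and the Fourier transform shows that there are at least
   as many nonzero principal right ideals as left ones. *)

Set Implicit Arguments.
Unset Strict Implicit.
Unset Printing Implicit Defensive.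

Import GRing.Theory Num.Theory.

Local Open Scope ring_scope.

(** * Principal right ideals and units in cosets *)

Section PrincipalIdeals.
Variable R : finUnitRingType.
Implicit Types (r s x u : R) (I J K : {set R}).

Lemma ridealP s x : reflect (exists r, x = s * r) (x \in rideal s).
Proof. by apply: (iffP imsetP) => [[r _ ->]|[r ->]]; exists r. Qed.

Lemma rideal_id s : s \in rideal s.
Proof. by apply/ridealP; exists 1; rewrite mulr1. Qed.

Lemma rideal_sub x s : (rideal x \subset rideal s) = (x \in rideal s).
Proof.
apply/subsetP/idP => [-> //|/ridealP[r ->] y /ridealP[t ->]].
  exact: rideal_id.
by apply/ridealP; exists (r * t); rewrite mulrA.
Qed.

Lemma rideal_eq0 s : (rideal s == [set 0]) = (s == 0).
Proof.
apply/eqP/eqP => [s0|->]; first by apply/set1P; rewrite -s0 rideal_id.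
by apply/setP=> x; rewrite !inE; apply/ridealP/eqP => [[r ->]|->];
  [|exists 0]; rewrite mul0r.
Qed.

(** From [u * v = 1], left multiplication by [v] is injective, hence surjective by finiteness, so
    [v] also has a right inverse. *)
Lemma rideal_full_unit u : 1 \in rideal u -> u \is a GRing.unit.
Proof.
case/ridealP=> v uv; apply/unitrP; exists v; split=> //.
have inj_v : injective ( *%R v).
  by move=> a b /= Eab; rewrite -[a]mul1r -[b]mul1r uv -!mulrA Eab.
have [g _ vgK] := injF_bij inj_v.
by rewrite -[u in v * u]mulr1 -(vgK 1) /= (mulrA u) -uv mul1r.
Qed.

(* For a principal right ideal I, both #|{u in I : u - 1 in K}| and
   #|{u in I : u - r in K}| count a coset of I :&: K as soon as they are nonzero,
   and they are nonzero simultaneously.  By inversion over the principal right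
   ideals, 1 + K and r + K contain equally many generators of R, and 1 + K
   contains one. *)
Lemma unit_in_coset K r s :
    {in K &, forall x y, x - y \in K} ->
    (forall x a, x \in K -> x * a \in K) ->
  r * s - 1 \in K -> exists2 u, u \is a GRing.unit & u - r \in K.
Proof.
move=> KB KM Krs; have K0 : 0 \in K by rewrite -(subrr (r * s - 1)) KB.
have KD : {in K &, forall x y, x + y \in K}.
  by move=> x y Kx Ky; rewrite -[y]opprK KB // -sub0r KB.
pose N c I := #|[set u | (u - c \in K) && (rideal u == I)]|.
pose S c I := #|[set u | (u - c \in K) && (rideal u \subset I)]|.
have SE c I : S c I = (N c I + \sum_(J : {set R} | J \proper I) N c J)%N.
  have -> : S c I = (\sum_(J : {set R} | J \subset I) N c J)%N.
    rewrite /S -sum1_card (partition_big (@rideal R) (fun J => J \subset I)) /=.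
      apply: eq_bigr => J sJI; rewrite /N -sum1_card; apply: eq_bigl => u.
      by rewrite !inE -andbA; case: eqP => [->|]; rewrite ?sJI ?andbF ?andbT.
    by move=> u; rewrite inE => /andP[].
  rewrite (bigD1 I) //=; congr (_ + _)%N; apply: eq_bigl => J.
  by rewrite properEneq andbC.
have leS c d a b y : a - c \in K -> a \in rideal y -> b - d \in K -> b \in rideal y ->
    (S c (rideal y) <= S d (rideal y))%N.
  move=> Kac /ridealP[a' Ea] Kbd /ridealP[b' Eb].
  rewrite /S -(card_imset _ (addIr (b - a))); apply: subset_leq_card.
  apply/subsetP=> _ /imsetP[u /[!inE]/[!rideal_sub] /andP[Kuc /ridealP[t Eu]] ->].
  apply/andP; split.
    suff -> : u + (b - a) - d = (u - c) - (a - c) + (b - d) by apply: KD => //; apply: KB.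
    by rewrite (opprB a) (addrA (u - c)) subrK (addrC b) !addrA.
  by apply/ridealP; exists (t + (b' - a')); rewrite Eu Ea Eb mulrDr mulrBr.
have SrE y : S r (rideal y) = S 1 (rideal y).
  have S_gt0 c : (0 < S c (rideal y))%N -> exists2 a, a - c \in K & a \in rideal y.
    by case/card_gt0P=> a /[!inE]/[!rideal_sub] /andP[? ?]; exists a.
  have rideal_mul a t : a \in rideal y -> a * t \in rideal y.
    by case/ridealP=> b ->; apply/ridealP; exists (b * t); rewrite mulrA.
  (* Right multiplication by [r] maps [1 + K] into [r + K], and by [s] it maps [r + K] into [1 + K],
     because [r * s] lies in [1 + K]. *)
  have to_r a : a - 1 \in K -> a * r - r \in K.
    by move=> Ka; rewrite -[X in _ - X]mul1r -mulrBl KM.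
  have to_1 a : a - r \in K -> a * s - 1 \in K.
    move=> Ka; have -> : a * s - 1 = (a - r) * s + (r * s - 1).
      by rewrite mulrBl addrA subrK.
    by apply: KD => //; apply: KM.
  apply/eqP; rewrite eqn_leq; apply/andP; split.
    have [->//|/S_gt0[a Ka Ia]] := posnP (S r (rideal y)).
    by apply: (leS _ _ a (a * s)); rewrite ?rideal_mul ?to_1.
  have [->//|/S_gt0[a Ka Ia]] := posnP (S 1 (rideal y)).
  by apply: (leS _ _ a (a * r)); rewrite ?rideal_mul ?to_r.
have NrE I : N r I = N 1 I.
  have [n] := ubnP #|I|; elim: n I => // n IHn I ltIn.
  have [y EI|noI] := pickP (fun y => I == rideal y); last first.
    by rewrite /N !eq_card0 // => u; rewrite !inE eq_sym noI andbF.
  move/eqP: EI ltIn => -> ltyn; have := SrE y; rewrite !SE.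
  rewrite (eq_bigr (N 1)) => [/addIn//|J /proper_card ltJ].
  by apply: IHn; apply: leq_trans ltJ _.
have: (0 < N 1%R [set: R])%N.
  apply/card_gt0P; exists 1; rewrite inE subrr K0; apply/eqP/setP=> x.
  by rewrite inE; apply/ridealP; exists x; rewrite mul1r.
rewrite -NrE => /card_gt0P[u]; rewrite inE => /andP[Ku /eqP uR].
by exists u => //; apply: rideal_full_unit; rewrite uR inE.
Qed.
End PrincipalIdeals.

(** * Unit factors between associated elements and functions *)

Section AssociatedFunctions.
Variable R : finUnitRingType.

(** The right annihilator [K] of the values of [b] is a right ideal containing [r * s - 1];
    replacing [r] by a unit of [r + K] leaves every [b x * r] unchanged. *)
Lemma unit_factor (X : finType) (a b : X -> R) r s :
    (forall x, a x = b x * r) -> (forall x, b x = a x * s) ->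
  exists2 u, u \is a GRing.unit & forall x, a x = b x * u.
Proof.
move=> ab ba; pose K := [set z | [forall x, b x * z == 0]].
have KP z : reflect (forall x, b x * z = 0) (z \in K).
  by rewrite inE; apply: (iffP forallP) => bz x; apply/eqP.
have [||| u Uu /KP bu] := @unit_in_coset R K r s.
- by move=> x y /KP bx /KP b_y; apply/KP=> z; rewrite mulrBr bx b_y subrr.
- by move=> x y /KP bx; apply/KP=> z; rewrite mulrA bx mul0r.
- by apply/KP=> x; rewrite mulrBr mulr1 mulrA -ab -ba subrr.
exists u => // x; apply/esym/eqP.
by rewrite ab -subr_eq0 -mulrBr bu.
Qed.

Lemma rideal_eq_unit (x y : R) :
  rideal x = rideal y -> exists2 u, u \is a GRing.unit & x = y * u.
Proof.
move=> Exy; have /ridealP[r Er] : x \in rideal y by rewrite -Exy rideal_id.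
have /ridealP[s Es] : y \in rideal x by rewrite Exy rideal_id.
have [u Uu /(_ tt) Eu] := @unit_factor unit (fun=> x) (fun=> y) r s (fun=> Er) (fun=> Es).
by exists u.
Qed.

Lemma rideal_unit (x u : R) : u \is a GRing.unit -> rideal (x * u) = rideal x.
Proof.
move=> Uu; apply/eqP; rewrite eqEsubset !rideal_sub.
apply/andP; split; apply/ridealP; first by exists u.
by exists u^-1; rewrite mulrK.
Qed.

End AssociatedFunctions.

(* Without this instance R^c : finUnitRingType unfolds to R, with its original product. *)
HB.instance Definition _ (R : finUnitRingType) := Finite.copy R^c R.

(** This is [unit_factor] read in the opposite ring. *)
Lemma lideal_eq_unit (R : finUnitRingType) (x y : R) :
  lideal x = lideal y -> exists2 u, u \is a GRing.unit & x = u * y.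
Proof.
move=> Exy; have /imsetP[r _ Er] : x \in lideal y.
  by rewrite -Exy; apply/imsetP; exists 1; rewrite ?mul1r.
have /imsetP[s _ Es] : y \in lideal x.
  by rewrite Exy; apply/imsetP; exists 1; rewrite ?mul1r.
have [u Uu /(_ tt) Eu] :=
  @unit_factor R^c unit (fun=> x) (fun=> y) r s (fun=> Er) (fun=> Es).
by exists u.
Qed.

Definition linear_on (R : finUnitRingType) n (C : {set 'rV[R]_n}) (g : 'rV[R]_n -> R) : Prop :=
  {in C &, forall x y, forall a, g (a *: x + y) = a * g x + g y}.

(** * Sums of a character whose kernel contains no nonzero left ideal *)

Section GeneratingCharacter.
Variables (R : finUnitRingType) (rho : addchar R).
Hypothesis rho_gen : forall z, (forall y, rho (y * z) = 1) -> z = 0.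

Lemma addchar0 : rho 0 = 1.
Proof.
apply: (mulfI (addchar_neq0 rho 0)).
by rewrite -addcharD addr0 mulr1.
Qed.

(** Translation by [x0] multiplies the sum by [F x0]. *)
Lemma sum_char_eq0 (V : finZmodType) (C : {set V}) (F : V -> algC) x0 :
    {in C &, forall x y, x - y \in C} -> {in C &, forall x y, F (x + y) = F x * F y} ->
  x0 \in C -> F x0 != 1 -> \sum_(x in C) F x = 0.
Proof.
move=> CB FD Cx0 Fx0; apply/eqP; apply: contraNT Fx0 => S_neq0.
apply/eqP/(mulIf S_neq0); rewrite mul1r mulr_sumr.
rewrite [RHS](reindex_inj (addrI x0)); apply: eq_big => [x|x Cx]; last by rewrite FD.
have C0 : 0 \in C by rewrite -(subrr x0) CB.
apply/idP/idP => Cx; last by rewrite -[x](addKr x0) addrC CB.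
by rewrite -[x]opprK CB // -sub0r CB.
Qed.

Lemma sum_genchar_linear n (C : {set 'rV[R]_n}) (g : 'rV[R]_n -> R) :
    submod_closed C -> linear_on C g ->
  \sum_(x in C) rho (g x) = #|C|%:R *+ [forall x in C, g x == 0].
Proof.
move=> [C0 CZ] gZ.
have gD : {in C &, forall x y, g (x + y) = g x + g y}.
  by move=> x y Cx Cy; have := gZ x y Cx Cy 1; rewrite scale1r mul1r.
have g0 : g 0 = 0 by apply: (addrI (g 0)); rewrite -gD ?addr0.
case: forall_inP => [g_eq0|/forall_inP].
  rewrite (eq_bigr (fun=> 1)) => [|x /g_eq0/eqP->]; last exact: addchar0.
  by rewrite sumr_const.
rewrite negb_forall_in => /exists_inP[x Cx gx].
have [y rho_y] : exists y, rho (y * g x) != 1.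
  apply/existsP; apply: contraNT gx; rewrite negb_exists => /forallP rho1.
  by apply/eqP/rho_gen=> y; apply/eqP; rewrite -[_ == _]negbK.
apply: (@sum_char_eq0 _ _ _ (y *: x)).
- by move=> z t Cz Ct; rewrite -scaleN1r addrC CZ.
- by move=> z t Cz Ct; rewrite gD // addcharD.
- by rewrite -[_ *: _]addr0 CZ.
by rewrite -[y *: x]addr0 gZ // g0 addr0.
Qed.

Lemma sum_gencharl z : \sum_y rho (y * z) = #|R|%:R *+ (z == 0).
Proof.
have [->|z_neq0] := eqVneq z 0.
  rewrite (eq_bigr (fun=> 1)) => [|y _]; first by rewrite sumr_const.
  by rewrite mulr0 addchar0.
have [y rho_y] : exists y, rho (y * z) != 1.
  apply/existsP; apply: contraNT z_neq0; rewrite negb_exists => /forallP rho1.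
  by apply/eqP/rho_gen=> y; apply/eqP; rewrite -[_ == _]negbK.
rewrite -(eq_bigl _ _ (in_setT (T := R))); apply: (sum_char_eq0 (x0 := y)) => //.
- by move=> a b _ _; rewrite inE.
- by move=> a b _ _; rewrite mulrDl addcharD.
Qed.

(** The hypothesis on [rho] concerns left ideals. Summing [rho (d * x)] over [d] and [x] in both
    orders gives [#|R| * #|A| = #|R|], so the kernel contains no nonzero right ideal either. *)
Lemma sum_gencharr c : \sum_x rho (c * x) = #|R|%:R *+ (c == 0).
Proof.
pose A := [set c | [forall x, rho (c * x) == 1]].
have sumA d : \sum_x rho (d * x) = #|R|%:R *+ (d \in A).
  rewrite inE; case: forallP => [rho1|/forallP].
    by rewrite (eq_bigr (fun=> 1)) => [|x _]; [rewrite sumr_const|apply/eqP].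
  rewrite negb_forall => /existsP[x rho_x].
  rewrite -(eq_bigl _ _ (in_setT (T := R))); apply: (sum_char_eq0 (x0 := x)) => //.
  - by move=> a b _ _; rewrite inE.
  - by move=> a b _ _; rewrite mulrDr addcharD.
have R_neq0 : #|R|%:R != 0 :> algC.
  by rewrite pnatr_eq0 -lt0n; apply/card_gt0P; exists 0.
have A0 : 0 \in A by rewrite inE; apply/forallP=> x; rewrite mul0r addchar0.
have : #|A| = 1%N.
  have : \sum_d \sum_x rho (d * x) = \sum_x \sum_d rho (d * x) by exact: exchange_big.
  rewrite (eq_bigr _ (fun d _ => sumA d)) [RHS](eq_bigr _ (fun x _ => sum_gencharl x)).
  rewrite !sumrMnr => /(mulrIn R_neq0).
  by rewrite -big_mkcond sum1_card -big_mkcond big_pred1_eq.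
move/eqP/cards1P=> [a Aa]; rewrite sumA Aa inE.
by move: A0; rewrite Aa inE => /eqP->.
Qed.

End GeneratingCharacter.

(** The character [f 1] works: if it is trivial on [R z], then [f z = z *: f 1] is trivial, and [f]
    is injective. *)
Lemma frobenius_genchar (R : finUnitRingType) :
  frobenius_ring R ->
  exists rho : addchar R, forall z, (forall y, rho (y * z) = 1) -> z = 0.
Proof.
move=> [f /bij_inj f_inj]; exists (f 1) => z rho_z; apply: f_inj.
have -> : f z = z *: f 1 by rewrite -linearZ /= /GRing.scale /= mulr1.
by rewrite linear0; apply: addcharP => x; rewrite !ffunE rho_z.
Qed.

(** * Cyclic right modules generated by functions *)

Section CyclicSubmodules.
Variables (R : finUnitRingType) (X : finType).
Implicit Types (g h nu : {ffun X -> R}) (D : {set {ffun X -> R}}).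

Definition rscale g (r : R) : {ffun X -> R} := [ffun x => g x * r].
Definition cyclic_submod g := [set rscale g r | r : R].
Definition fiber_card g nu := #|[set r | rscale g r == nu]|.

Lemma cyclic_id g : g \in cyclic_submod g.
Proof. by apply/imsetP; exists 1 => //; apply/ffunP=> x; rewrite ffunE mulr1. Qed.

Lemma cyclic_sub g h : g \in cyclic_submod h -> cyclic_submod g \subset cyclic_submod h.
Proof.
case/imsetP=> r _ ->; apply/subsetP=> _ /imsetP[s _ ->]; apply/imsetP.
by exists (r * s) => //; apply/ffunP=> x; rewrite !ffunE mulrA.
Qed.

Lemma cyclic_eq_unit g h : cyclic_submod g = cyclic_submod h ->
  exists2 u, u \is a GRing.unit & g = rscale h u.
Proof.
move=> Egh; have /imsetP[r _ /ffunP Eg] : g \in cyclic_submod h.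
  by rewrite -Egh cyclic_id.
have /imsetP[s _ /ffunP Eh] : h \in cyclic_submod g by rewrite Egh cyclic_id.
have [||u Uu gu] := @unit_factor _ X g h r s.
- by move=> x; rewrite {1}Eg ffunE.
- by move=> x; rewrite {1}Eh ffunE.
by exists u => //; apply/ffunP=> x; rewrite ffunE.
Qed.

Lemma fiber_card_cyclic g h nu :
  cyclic_submod g = cyclic_submod h -> fiber_card g nu = fiber_card h nu.
Proof.
case/cyclic_eq_unit=> u Uu ->.
rewrite /fiber_card -[RHS](card_preimset _ (mulrI Uu)); apply: eq_card => r.
by rewrite !inE; congr (_ == _); apply/ffunP=> x; rewrite !ffunE mulrA.
Qed.

Lemma fiber_card_gt0 g nu : (0 < fiber_card g nu)%N = (nu \in cyclic_submod g).
Proof.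
apply/card_gt0P/imsetP => [[r /[!inE]/eqP<-]|[r _ ->]]; exists r => //.
by rewrite inE.
Qed.

(* Downward induction on D: at a generator nu of D, only the submodules D' containing
   D contribute to the sum, each with a weight depending on D' and nu only. *)
Lemma cyclic_count_eq (I : finType) (l m : I -> {ffun X -> R}) :
    (forall nu, (exists j, (nu == l j) || (nu == m j)) ->
      \sum_i fiber_card (l i) nu = \sum_i fiber_card (m i) nu)%N ->
  forall D, #|[set i | cyclic_submod (l i) == D]| = #|[set i | cyclic_submod (m i) == D]|.
Proof.
move=> Elm D; have [n] := ubnP #|~: D|; elim: n D => // n IHn D ltDn.
have [nu /andP[/existsP ex_nu /eqP Dnu]|noD] :=
    pickP [pred nu | [exists j, (nu == l j) || (nu == m j)] & cyclic_submod nu == D];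
    last first.
  rewrite !eq_card0 // => i; rewrite inE; apply/negbTE/negP=> iD.
    have /negP[] := negbT (noD (m i)); rewrite /= iD andbT.
    by apply/existsP; exists i; rewrite eqxx orbT.
  have /negP[] := negbT (noD (l i)); rewrite /= iD andbT.
  by apply/existsP; exists i; rewrite eqxx.
(* The common value of [fiber_card g nu] over the generators [g] of [D']; the default 0 is met only
   by noncyclic [D'], whose count is zero. *)
pose c D' := if [pick g | cyclic_submod g == D'] is Some g then fiber_card g nu else 0%N.
have sumE (k : I -> {ffun X -> R}) : (\sum_i fiber_card (k i) nu =
    \sum_D' #|[set i | cyclic_submod (k i) == D']| * c D')%N.
  rewrite (partition_big (fun i => cyclic_submod (k i)) xpredT) //=.
  apply: eq_bigr => D' _; rewrite -sum_nat_const; apply: eq_big => [i|i /eqP kiD'].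
    by rewrite inE.
  rewrite /c; case: pickP => [g /eqP gD'|/(_ (k i))]; last by rewrite kiD' eqxx.
  by apply: fiber_card_cyclic; rewrite gD'.
have := Elm nu ex_nu; rewrite !sumE (bigD1 D) //= [in RHS](bigD1 D) //=.
rewrite (eq_bigr (fun D' => #|[set i | cyclic_submod (m i) == D']| * c D')%N); last first.
  move=> D' neqD; rewrite /c; case: pickP => [g /eqP gD'|_]; last by rewrite !muln0.
  have [->|] := posnP (fiber_card g nu); first by rewrite !muln0.
  rewrite fiber_card_gt0 => /cyclic_sub; rewrite Dnu gD' => sDD'.
  congr (_ * _)%N; apply: IHn; rewrite -ltnS; apply: leq_trans ltDn; rewrite ltnS.
  by apply: proper_card; rewrite properC properEneq eq_sym neqD.
move/addIn/eqP; rewrite eqn_pmul2r => [/eqP//|].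
rewrite /c; case: pickP => [g /eqP gD|/(_ nu)]; last by rewrite Dnu eqxx.
by rewrite fiber_card_gt0 gD -Dnu cyclic_id.
Qed.

Lemma perm_of_cyclic_count n (l m : 'I_n -> {ffun X -> R}) :
    (forall D, #|[set i | cyclic_submod (l i) == D]| =
      #|[set i | cyclic_submod (m i) == D]|) ->
  exists (s : 'S_n) (u : 'I_n -> R),
    forall i, u i \is a GRing.unit /\ m i = rscale (l (s i)) (u i).
Proof.
move=> Elm; pose t k := [tuple cyclic_submod (k i : {ffun X -> R}) | i < n].
have tE k D : count_mem D (t k) = #|[set i | cyclic_submod (k i) == D]|.
  rewrite count_map -sum1_count big_enum_cond /= -sum1_card.
  by apply: eq_bigl => i; rewrite !inE.
have /tuple_permP[s Es] : perm_eq (t m) (t l).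
  by apply/allP=> D _ /=; apply/eqP; rewrite !tE Elm.
have Ecyc i : cyclic_submod (m i) = cyclic_submod (l (s i)).
  have : tnth (t m) i = tnth (t l) (s i) by rewrite (val_inj Es) tnth_mktuple.
  by rewrite !tnth_mktuple.
have ex_u i : exists u : R, (u \is a GRing.unit) && (m i == rscale (l (s i)) u).
  by have [u Uu Eu] := cyclic_eq_unit (Ecyc i); exists u; rewrite Uu Eu eqxx.
exists s, (fun i => xchoose (ex_u i)) => i.
by have /andP[Uu /eqP] := xchooseP (ex_u i).
Qed.

End CyclicSubmodules.

(** * The extension theorem for the Hamming weight *)

Lemma card_set_sum (T : finType) (P : pred T) : #|[set x | P x]| = (\sum_x P x)%N.
Proof. by rewrite -sum1dep_card big_mkcond. Qed.

Lemma hamming_extension (R : finUnitRingType) n k (C : {set 'rV[R]_k})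
    (l m : 'I_n -> 'rV[R]_k -> R) :
    frobenius_ring R -> submod_closed C ->
    (forall i, linear_on C (l i)) ->
    (forall i, linear_on C (m i)) ->
    {in C, forall x, #|[set i | l i x == 0]| = #|[set i | m i x == 0]|} ->
  exists (s : 'S_n) (u : 'I_n -> R),
    (forall i, u i \is a GRing.unit) /\
    (forall i, {in C, forall x, m i x = l (s i) x * u i}).
Proof.
move=> /frobenius_genchar[rho rho_gen] Csub lin_l lin_m Elm.
(* Extension by 0 outside [C] turns agreement on [C] into equality of functions. *)
pose res (g : 'rV[R]_k -> R) : {ffun 'rV[R]_k -> R} :=
  [ffun x => if x \in C then g x else 0].
have [D|s [u us]] := @perm_of_cyclic_count R _ n (res \o l) (res \o m); last first.
  exists s, u; split=> i => [|x Cx]; first by have [] := us i.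
  by have [_ /ffunP/(_ x)] := us i; rewrite !ffunE Cx.
apply: cyclic_count_eq => nu ex_nu {D}.
(* Being one of the given functionals, [nu] is linear on [C], as the character sums over [C]
   require. *)
have [h lin_h nuE] : exists2 h, linear_on C h
    & nu = res h.
  by case: ex_nu => j /orP[]/eqP->; [exists (l j)|exists (m j)].
have C_neq0 : #|C|%:R != 0 :> algC.
  by case: Csub => C0 _; rewrite pnatr_eq0 -lt0n; apply/card_gt0P; exists 0.
(* Both sides evaluate the sum of [rho (g i x * r - h x)] over [i], [r] and [x] in [C]: summing
   first over [x] detects [g i x * r = h x] on [C], summing first over [r] detects [g i x = 0]. *)
have sumE (g : 'I_n -> 'rV[R]_k -> R) :
    (forall i, linear_on C (g i)) ->
    #|C|%:R *+ (\sum_i fiber_card (res (g i)) nu) =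
    \sum_(x in C) rho (- h x) * (#|R|%:R *+ #|[set i | g i x == 0]|).
  move=> lin_g; rewrite -sumrMnr.
  under [RHS]eq_bigr => x _.
    rewrite card_set_sum -sumrMnr mulr_sumr.
    under eq_bigr => i _.
      rewrite -(sum_gencharr rho_gen) mulr_sumr.
      under eq_bigr do rewrite -addcharD addrC.
      over.
    over.
  rewrite [RHS]exchange_big /=; apply: eq_bigr => i _.
  rewrite exchange_big /= /fiber_card card_set_sum -sumrMnr.
  apply: eq_bigr => r _.
  rewrite (sum_genchar_linear rho_gen Csub (g := fun x => g i x * r - h x)).
    congr (_ *+ nat_of_bool _).
    case: forall_inP => [gh|gh]; case: eqP => // E.
      case: E; apply/ffunP=> x; rewrite nuE !ffunE.
      by case: ifP => [/gh|]; [rewrite subr_eq0 => /eqP | rewrite mul0r].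
    case: gh => x Cx; move/ffunP/(_ x): E; rewrite nuE !ffunE Cx => ->.
    by rewrite subrr.
  move=> x y Cx Cy a; rewrite lin_g // lin_h // mulrDl opprD mulrBr mulrA.
  by rewrite addrACA.
apply: (mulrIn C_neq0); rewrite !sumE //.
by apply: eq_bigr => x Cx; rewrite Elm.
Qed.

(** * Sufficiency: recovering the number of zeros from the weights *)

Section Orthogonality.
Variable R : finUnitRingType.

Lemma rgenK (s : R) : rideal (rgen (rideal s)) = rideal s.
Proof. by rewrite /rgen; case: pickP => [x /eqP//|/(_ s)]; rewrite eqxx. Qed.

Lemma lgenK (r : R) : lideal (lgen (lideal r)) = lideal r.
Proof. by rewrite /lgen; case: pickP => [x /eqP//|/(_ r)]; rewrite eqxx. Qed.

Lemma mem_nz_rideals (x : R) : (rideal x \in nz_rideals R) = (x != 0).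
Proof.
apply/imsetP/idP => [[y /[!inE] y_neq0 Exy]|x_neq0].
  by rewrite -rideal_eq0 Exy.
by exists x; rewrite // inE rideal_eq0.
Qed.

(** Generators of one right ideal differ by units, so [F] is determined by its values at the chosen
    generators. *)
Lemma sum_nz_rideals (F : R -> rat) x :
    F 0 = 0 -> (forall y u, u \is a GRing.unit -> F (y * u) = F y) ->
  \sum_(j < #|nz_rideals R|) F (rgen (enum_val j)) * (rideal x == enum_val j)%:R = F x.
Proof.
move=> F0 FU; have [->|] := eqVneq x 0.
  rewrite F0 big1 // => j _; case: eqP => [E|_]; last by rewrite mulr0.
  by have := enum_valP j; rewrite -E mem_nz_rideals eqxx.
rewrite -mem_nz_rideals => Ix; rewrite (bigD1 (enum_rank_in Ix (rideal x))) //=.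
rewrite big1 => [|j neq_j].
  rewrite enum_rankK_in // eqxx mulr1 addr0.
  by have [u Uu {2}->] := rideal_eq_unit (esym (rgenK x)); rewrite FU.
case: eqP => [E|_]; last by rewrite mulr0.
by case/eqP: neq_j; apply: enum_val_inj; rewrite enum_rankK_in.
Qed.

(* The hypothesis determines, for every nonzero principal right ideal, the number of
   entries generating it. *)
Lemma orthogonality_zeros (w : R -> rat) n (x y : 'I_n -> R) :
    bi_invariant w -> w 0 = 0 -> (exists B, B *m orthogonality_mx w = 1%:M) ->
    (forall r, \sum_i w (r * x i) = \sum_i w (r * y i)) ->
  #|[set i | x i == 0]| = #|[set i | y i == 0]|.
Proof.
move=> w_inv w0 [B BW] Exy.
pose d (z : 'I_n -> R) : 'cV[rat]_#|nz_rideals R| :=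
  \col_j \sum_i (rideal (z i) == enum_val j)%:R.
have sum_d F (z : 'I_n -> R) : F 0 = 0 ->
    (forall t u, u \is a GRing.unit -> F (t * u) = F t) ->
    \sum_j F (rgen (enum_val j)) * d z j 0 = \sum_i F (z i).
  move=> F0 FU; under eq_bigr do rewrite mxE mulr_sumr.
  by rewrite exchange_big; apply: eq_bigr => i _; apply: sum_nz_rideals.
have Ed : d x = d y.
  rewrite -[d x]mul1mx -[d y]mul1mx -BW -!mulmxA; congr (_ *m _).
  apply/colP=> k; rewrite !mxE; under eq_bigr do rewrite mxE.
  under [RHS]eq_bigr do rewrite mxE.
  set r := lgen _; rewrite !(sum_d (fun t => w (r * t))) // => [|t u Uu||t u Uu].
  - by rewrite mulr0.
  - by rewrite mulrA; case: (w_inv (r * t) u Uu).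
  - by rewrite mulr0.
  - by rewrite mulrA; case: (w_inv (r * t) u Uu).
(* Since [sum_d] asks for functions vanishing at 0, the nonzero entries are counted and subtracted
   from [n]. *)
have E0 (z : 'I_n -> R) : n%:R - \sum_i (z i != 0)%:R = #|[set i | z i == 0]|%:R :> rat.
  have -> : n%:R = \sum_(i < n) 1 :> rat by rewrite sumr_const card_ord.
  rewrite card_set_sum natr_sum -sumrB.
  by apply: eq_bigr => i _; case: eqP; rewrite ?subrr ?subr0.
apply/eqP; rewrite -(eqr_nat rat) -!E0.
have sum_nz z : \sum_j (rgen (enum_val j) != 0)%:R * d z j 0 = \sum_i (z i != 0)%:R.
  apply: (sum_d (fun t => (t != 0)%:R)) => [|t u Uu]; first by rewrite eqxx.
  by rewrite -{1}(mul0r u) (inj_eq (mulIr Uu)).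
by rewrite -!sum_nz Ed.
Qed.

Lemma extension_of_orthogonality (w : R -> rat) :
    frobenius_ring R -> bi_invariant w -> w 0 = 0 ->
    (exists B, B *m orthogonality_mx w = 1%:M) -> extension_property w.
Proof.
move=> frobR w_inv w0 W_inv n n_gt0 C Csub f [f_lin f_wt] _.
have [C0 CZ] := Csub.
have f0 : f 0 = 0.
  by apply: (addrI (f 0)); rewrite addr0 -{1}[f 0]scale1r -f_lin // scaler0 addr0.
have [||x Cx|s [u [Uu su]]] :=
  @hamming_extension R n n C (fun i x => x 0 i) (fun i x => f x 0 i) frobR Csub.
- by move=> i x y _ _ a; rewrite !mxE.
- by move=> i x y Cx Cy a; rewrite f_lin // !mxE.
- apply: (orthogonality_zeros w_inv w0 W_inv) => r.
  have Crx : r *: x \in C by rewrite -[_ *: _]addr0 CZ.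
  have := f_wt _ Crx; rewrite -[r *: x]addr0 f_lin // f0 !addr0.
  rewrite /code_weight => /esym; under eq_bigr do rewrite mxE.
  by under [RHS]eq_bigr do rewrite mxE.
exists s, u; split=> [i|x Cx].
  by split=> // x; case: (w_inv x (u i) (Uu i)).
by apply/rowP=> i; rewrite mxE su.
Qed.

End Orthogonality.

(** * Comparison of the numbers of principal left and right ideals *)

Section Dimension.
Variable R : finUnitRingType.

Lemma lideal0 : lideal (0 : R) = [set 0].
Proof.
apply/setP=> x; rewrite !inE; apply/imsetP/eqP => [[r _ ->]|->].
  by rewrite mulr0.
by exists 0; rewrite ?mulr0.
Qed.

Lemma lideal_unit (u x : R) : u \is a GRing.unit -> lideal (u * x) = lideal x.
Proof.
move=> Uu; apply/setP=> y; apply/imsetP/imsetP => [[r _ ->]|[r _ ->]].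
  by exists (r * u); rewrite // mulrA.
by exists (r * u^-1); rewrite // mulrA mulrVK.
Qed.

Lemma lideal_eq0 (x : R) : (lideal x == [set 0]) = (x == 0).
Proof.
apply/eqP/eqP => [x0|->]; last exact: lideal0.
by apply/set1P; rewrite -x0; apply/imsetP; exists 1; rewrite ?mul1r.
Qed.

Lemma mem_nz_lideals (x : R) : (lideal x \in nz_lideals R) = (x != 0).
Proof.
apply/imsetP/idP => [[y /[!inE] y_neq0 Exy]|x_neq0].
  by rewrite -lideal_eq0 Exy.
by exists x; rewrite // inE lideal_eq0.
Qed.

(* A function f with f x depending only on R x has a Fourier transform
   y |-> \sum_x f x * rho (y * x) depending only on y R, and Fourier inversion makes the
   resulting linear map injective. *)
Lemma card_nz_lideals_le : frobenius_ring R -> (#|nz_lideals R| <= #|nz_rideals R|)%N.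
Proof.
case/frobenius_genchar=> rho rho_gen.
pose A : 'M[algC]_(#|nz_lideals R|, #|nz_rideals R|) :=
  \matrix_(i, j) \sum_(x | lideal x == enum_val i) rho (rgen (enum_val j) * x).
suff /eqP <- : row_free A by apply: rank_leq_col.
apply: inj_row_free => v vA.
pose f x := \sum_i v 0 i * (lideal x == enum_val i)%:R.
pose F y := \sum_x f x * rho (y * x).
have f0 : f 0 = 0.
  rewrite /f big1 // => i _; case: eqP => [E|_]; last by rewrite mulr0.
  by have := enum_valP i; rewrite -E mem_nz_lideals eqxx.
have F_unit y u : u \is a GRing.unit -> F (y * u) = F y.
  move=> Uu; rewrite /F [RHS](reindex_inj (mulrI Uu)); apply: eq_bigr => x _.
  by rewrite /f lideal_unit // mulrA.
have F_gen (j : 'I_#|nz_rideals R|) : F (rgen (enum_val j)) = 0.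
  have := congr1 (fun B : 'rV_#|nz_rideals R| => B 0 j) vA; rewrite !mxE => <-.
  rewrite /F; under eq_bigr do rewrite mulr_suml.
  rewrite exchange_big; apply: eq_bigr => i _; rewrite mxE mulr_sumr [RHS]big_mkcond.
  by apply: eq_bigr => x _; case: eqP; rewrite ?mulr1 ?mulr0 ?mul0r.
have F_neq0 y : y != 0 -> F y = 0.
  rewrite -mem_nz_rideals => Iy; have [u Uu ->] := rideal_eq_unit (esym (rgenK y)).
  by rewrite F_unit // -(enum_rankK_in Iy Iy) F_gen.
have R_neq0 : #|R|%:R != 0 :> algC.
  by rewrite pnatr_eq0 -lt0n; apply/card_gt0P; exists 0.
(* As [F] vanishes off 0, Fourier inversion makes [f] constant, and [f 0 = 0]. *)
have f_inv z : #|R|%:R * f z = F 0.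
  transitivity (\sum_y F y * rho (y * - z)).
    under [RHS]eq_bigr do rewrite mulr_suml.
    rewrite exchange_big (bigD1 z) //= [X in _ + X]big1 => [|x neq_xz].
      under eq_bigr => y _ do rewrite -mulrA -addcharD -mulrDr subrr.
      by rewrite -mulr_sumr (sum_gencharl rho_gen) eqxx mulrC addr0.
    under eq_bigr => y _ do rewrite -mulrA -addcharD -mulrDr.
    by rewrite -mulr_sumr (sum_gencharl rho_gen) subr_eq0 (negPf neq_xz) mulr0.
  rewrite (bigD1 0) //= big1 => [|y /F_neq0->]; last by rewrite mul0r.
  by rewrite mul0r addchar0 mulr1 addr0.
have f_eq0 z : f z = 0 by apply: (mulfI R_neq0); rewrite f_inv -(f_inv 0) f0.
apply/rowP=> i; rewrite mxE -(f_eq0 (lgen (enum_val i))) /f.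
have -> : lideal (lgen (enum_val i)) = enum_val i.
  by have /imsetP[r _ ->] := enum_valP i; rewrite lgenK.
rewrite (bigD1 i) //= eqxx mulr1 big1 ?addr0 // => j neq_ji.
by rewrite (inj_eq enum_val_inj) eq_sym (negPf neq_ji) mulr0.
Qed.

End Dimension.

(** * Necessity: words built from a kernel vector *)

Definition row_of_seq (R : finUnitRingType) n (s : seq R) : 'rV[R]_n :=
  \row_i nth 0 s i.

Lemma sum_row_of_seq (R : finUnitRingType) n (s : seq R) (F : R -> rat) :
  size s = n -> \sum_i F (row_of_seq n s 0 i) = \sum_(a <- s) F a.
Proof.
move=> <-; rewrite (big_nth 0) big_mkord.
by apply: eq_bigr => i _; rewrite mxE.
Qed.

Section Necessity.
Variables (R : finUnitRingType) (w : R -> rat).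
Hypotheses (w_inv : bi_invariant w) (w0 : w 0 = 0).

Let k := #|nz_rideals R|.
Let gen (j : 'I_k) : R := rgen (enum_val j).

Definition blocks (p : 'I_k -> nat) : seq R :=
  flatten [seq nseq (p j) (gen j) | j <- enum 'I_k].

Lemma sum_blocks p (F : R -> rat) : \sum_(a <- blocks p) F a = \sum_j F (gen j) *+ p j.
Proof.
rewrite big_flatten big_map big_enum; apply: eq_bigr => j _.
by rewrite big_nseq iter_addr_0.
Qed.

(** The leading 1 lets a multiple of the word determine its scalar; the zeros equalise lengths
    without changing weights. *)
Definition word p n : seq R := 1 :: blocks p ++ nseq n 0.

Lemma sum_word p n (F : R -> rat) :
  F 0 = 0 -> \sum_(a <- word p n) F a = F 1 + \sum_j F (gen j) *+ p j.
Proof.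
move=> F0; rewrite big_cons big_cat sum_blocks /= big_nseq iter_addr_0 F0.
by rewrite mul0rn addr0.
Qed.

Lemma multiplicity_eq p q : extension_property w ->
    (forall r, \sum_j w (r * gen j) *+ p j = \sum_j w (r * gen j) *+ q j) ->
  p =1 q.
Proof.
move=> EP Epq j.
set n := (size (blocks p) + size (blocks q)).+1.
pose xs := word p (size (blocks q)); pose ys := word q (size (blocks p)).
have sx : size xs = n by rewrite /= size_cat size_nseq.
have sy : size ys = n by rewrite /= size_cat size_nseq addnC.
pose x := row_of_seq n xs; pose y := row_of_seq n ys.
have x1 : x 0 0 = 1 by rewrite mxE.
have y1 : y 0 0 = 1 by rewrite mxE.
pose C := [set a *: x | a : R].
(* The first coordinate recovers the scalar, so [z 0 0 *: y] describes the map [r *: x |-> r *: y]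
   on [C]. *)
have CP (z : 'rV[R]_n) : reflect (z = z 0 0 *: x) (z \in C).
  apply: (iffP imsetP) => [[a _ ->]|->]; last by exists (z 0 0).
  by rewrite mxE x1 mulr1.
have [|||s [u [Us Eyx]]] := EP n isT C _ (fun z : 'rV[R]_n => z 0 0 *: y).
- split=> [|a b c /CP-> /CP->]; first by apply/CP; rewrite mxE scale0r.
  by rewrite scalerA -scalerDl; apply/imsetP; exists (a * b 0 0 + c 0 0).
- split=> [a b _ _ c|z /CP->]; first by rewrite !mxE scalerDl scalerA.
  rewrite mxE x1 mulr1; set r := z 0 0; rewrite /code_weight.
  under eq_bigr do rewrite mxE; under [RHS]eq_bigr do rewrite mxE.
  rewrite (sum_row_of_seq (fun a => w (r * a)) sx) (sum_row_of_seq (fun a => w (r * a)) sy).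
  by rewrite !sum_word ?mulr0 // Epq.
- move=> a b /CP Ea /CP Eb /(congr1 (fun z : 'rV_n => z 0 0)) /=.
  by rewrite !mxE !mulr1 => Eab; rewrite Ea Eb Eab.
have Cx : x \in C by apply/imsetP; exists 1; rewrite ?scale1r.
have {Eyx} Eyx i : y 0 i = x 0 (s i) * u i.
  by have /rowP/(_ i) := Eyx x Cx; rewrite x1 scale1r [in RHS]mxE.
(* A monomial map with unit factors preserves the sum of [F] over the entries, which is [F 1 + p j]
   for [x] and [F 1 + q j] for [y]. *)
pose F (a : R) : rat := (rideal a == enum_val j)%:R.
have F0 : F 0 = 0.
  rewrite /F; case: eqP => // E.
  by have := enum_valP j; rewrite -E mem_nz_rideals eqxx.
have sumF (c : 'I_k -> nat) : \sum_i F (gen i) *+ c i = (c j)%:R.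
  have genE i : rideal (gen i) = enum_val i.
    by rewrite /gen; have /imsetP[r _ ->] := enum_valP i; rewrite rgenK.
  rewrite (bigD1 j) //= big1 => [|i neq_ij]; rewrite /F genE (inj_eq enum_val_inj).
    by rewrite eqxx addr0.
  by rewrite (negPf neq_ij) mul0rn.
have : \sum_i F (x 0 i) = \sum_i F (y 0 i).
  rewrite (reindex_perm s); apply: eq_bigr => i _.
  by rewrite Eyx /F rideal_unit //; case: (Us i).
rewrite (sum_row_of_seq F sx) (sum_row_of_seq F sy) !sum_word // !sumF.
by move/addrI/eqP; rewrite eqr_nat => /eqP.
Qed.

Lemma orthogonality_ker (d : 'cV[rat]_k) :
  extension_property w -> orthogonality_mx w *m d = 0 -> d = 0.
Proof.
move=> EP Wd.
pose N : int := \prod_j denq (d j 0).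
have N_neq0 : N%:~R != 0 :> rat.
  by rewrite intr_eq0; apply/prodf_neq0=> j _; apply: denq_neq0.
have [z zE] : exists z : 'I_k -> int, forall j, N%:~R * d j 0 = (z j)%:~R.
  exists (fun j => \prod_(i | i != j) denq (d i 0) * numq (d j 0)) => j.
  by rewrite /N (bigD1 j) //= !intrM numqE [RHS]mulrA [RHS]mulrC mulrA.
pose p j := if z j is Posz n then n else 0%N.
pose q j := if z j is Negz n then n.+1 else 0%N.
have pqE j : (z j)%:~R = (p j)%:R - (q j)%:R :> rat.
  by rewrite /p /q; case: (z j) => n; rewrite ?subr0 // NegzE mulrNz sub0r.
have /(multiplicity_eq EP) Epq r :
    \sum_j w (r * gen j) *+ p j = \sum_j w (r * gen j) *+ q j.
  have [->|] := eqVneq r 0.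
    by rewrite !big1 // => j _; rewrite mul0r w0 mul0rn.
  rewrite -mem_nz_lideals => Ir.
  (* Left invariance of [w] carries the equation from the chosen generator of [R r] to [r]
     itself. *)
  have [u Uu Er] := lideal_eq_unit (esym (lgenK r)).
  apply/eqP; rewrite -subr_eq0 -sumrB; apply/eqP.
  have /(congr1 (fun B : 'cV_#|nz_lideals R| =>
    N%:~R * B (enum_rank_in Ir (lideal r)) 0)) := Wd.
  rewrite !mxE mulr0 => W_r; rewrite -[RHS]W_r mulr_sumr; apply: eq_bigr => j _.
  rewrite mxE enum_rankK_in // mulrCA zE pqE mulrBr !mulr_natr {1 2}Er -mulrA.
  by case: (w_inv (lgen (lideal r) * gen j) Uu) => -> _.
apply/colP=> j; apply: (mulfI N_neq0).
by rewrite zE pqE Epq subrr mxE mulr0.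
Qed.

End Necessity.

(** * From full column rank to a two-sided inverse *)

Theorem theorem3p3 (R : finUnitRingType) (w : R -> rat) :
  frobenius_ring R -> bi_invariant w -> w 0 = 0 ->
  (extension_property w <-> mx_invertible (orthogonality_mx w)).
Proof.
move=> frobR w_inv w0; split=> [EP|[B [_ BW]]]; last first.
  by apply: extension_of_orthogonality => //; exists B.
set W := orthogonality_mx w.
have /eqP rkW : \rank W == #|nz_rideals R|.
  rewrite -mxrank_tr; apply: inj_row_free => v vW.
  apply: trmx_inj; rewrite trmx0; apply: (orthogonality_ker w_inv w0 EP).
  by apply: trmx_inj; rewrite trmx_mul trmxK vW trmx0.
have fullW : row_full W by rewrite /row_full rkW.
(* The rank equals the number of columns, which is at least the number of rows, so the rows are
   independent too. *)
have freeW : row_free W.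
  rewrite /row_free eqn_leq rank_leq_row rkW; exact: card_nz_lideals_le.
have [[B BW] [B' WB']] := (row_fullP fullW, row_freeP freeW).
exists B; split=> //.
by rewrite -[B]mulmx1 -WB' (mulmxA B) BW mul1mx WB'.
Qed.
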